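(* For every group $G$ there exists an Alexandroff space $X$ such that the group $\mathrm{Aut}(X)$ of homeomorphisms $X\to X$ (under composition) is isomorphic to $G$.
   Context: An Alexandroff space is a topological space in which arbitrary intersections of open sets are open. *)

(* Defs.v *)
From HB Require Import structures.
From mathcomp Require Import all_boot.
From mathcomp Require Import boolp classical_sets topology.
Set Implicit Arguments.
Unset Strict Implicit.
Unset Printing Implicit Defensive.

Local Open Scope classical_set_scope.

(* [F] is an arbitrary, possibly infinite or empty, family of open sets. *)
Definition alexandroff (X : topologicalType) : Prop :=
  forall F : set (set X), F `<=` open -> open (\bigcap_(U in F) U).

Definition homeomorphism (X Y : topologicalType) (f : X -> Y) : Prop :=
  continuous f /\ exists g : Y -> X, [/\ continuous g, cancel f g & cancel g f].

Record autohomeo (X : topologicalType) : Type := Autohomeo {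
  autohomeo_fun :> X -> X;
  autohomeoP : homeomorphism autohomeo_fun }.

Section AutohomeoGroup.
Variable X : topologicalType.
Implicit Types f g h : autohomeo X.

HB.instance Definition _ := gen_eqMixin (autohomeo X).
HB.instance Definition _ := gen_choiceMixin (autohomeo X).

Lemma autohomeo_eq f g : f =1 g -> f = g.
Proof.
case: f g => [f fP] [g gP] /= /funext fg.
by rewrite fg in fP *; rewrite (Prop_irrelevance fP gP).
Qed.

Fact homeomorphism_id : homeomorphism (@id X).
Proof.
by split; [move=> x; exact: cvg_id | exists id; split=> // x; exact: cvg_id].
Qed.

Fact homeomorphism_comp f g : homeomorphism (f \o g).
Proof.
have [fC [f' [f'C fK f'K]]] := autohomeoP f.
have [gC [g' [g'C gK g'K]]] := autohomeoP g.
split; first by move=> x; apply: continuous_comp; [exact: gC | exact: fC].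
exists (g' \o f'); split; [|exact: can_comp|exact: can_comp].
by move=> x; apply: continuous_comp; [exact: f'C | exact: g'C].
Qed.

Definition autohomeo_inv_fun f : X -> X := projT1 (cid (autohomeoP f).2).

Fact autohomeo_inv_funP f :
  [/\ continuous (autohomeo_inv_fun f), cancel f (autohomeo_inv_fun f)
    & cancel (autohomeo_inv_fun f) f].
Proof. exact: projT2 (cid (autohomeoP f).2). Qed.

Fact homeomorphism_inv f : homeomorphism (autohomeo_inv_fun f).
Proof.
have [gC fK gK] := autohomeo_inv_funP f.
by split=> //; exists f; split=> //; exact: (autohomeoP f).1.
Qed.

Definition autohomeo_one : autohomeo X := Autohomeo homeomorphism_id.
Definition autohomeo_mul f g : autohomeo X :=
  Autohomeo (homeomorphism_comp f g).
Definition autohomeo_inv f : autohomeo X := Autohomeo (homeomorphism_inv f).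

Fact autohomeo_mulA : associative autohomeo_mul.
Proof. by move=> f g h; exact: autohomeo_eq. Qed.

Fact autohomeo_mul1 : left_id autohomeo_one autohomeo_mul.
Proof. by move=> f; exact: autohomeo_eq. Qed.

Fact autohomeo_mulr1 : right_id autohomeo_one autohomeo_mul.
Proof. by move=> f; exact: autohomeo_eq. Qed.

Fact autohomeo_mulV : left_inverse autohomeo_one autohomeo_inv autohomeo_mul.
Proof.
by move=> f; apply: autohomeo_eq => x /=; have [_ + _] := autohomeo_inv_funP f.
Qed.

Fact autohomeo_mulrV : right_inverse autohomeo_one autohomeo_inv autohomeo_mul.
Proof.
by move=> f; apply: autohomeo_eq => x /=; have [_ _ +] := autohomeo_inv_funP f.
Qed.

HB.instance Definition _ := isGroup.Build (autohomeo X)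
  autohomeo_mulA autohomeo_mul1 autohomeo_mulr1 autohomeo_mulV autohomeo_mulrV.

End AutohomeoGroup.

(* Main.v *)
Require Import Defs.
From HB Require Import structures.
From mathcomp Require Import all_boot.
From mathcomp Require Import boolp classical_sets wochoice.
From mathcomp Require Import topology.

(* Fix a well-order on G and give each element k of G a minimal point (k, None)
   and a copy {g} x G of the well-ordered set G for every g, putting (k, None)
   below (g, Some j) when k^-1 g <= j.  An automorphism of this poset permutes
   the minimal points and the copies; since well-orders are rigid it maps each
   copy onto another without moving the second coordinate.  Reading off for
   which j the point (g, Some j) lies above (k, None), it preserves k^-1 g, so
   it is a left translation.  The up-sets of the poset form the wanted
   topology. *)

Set Implicit Arguments.
Unset Strict Implicit.
Unset Printing Implicit Defensive.

Local Open Scope classical_set_scope.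
Local Open Scope group_scope.

(** * Up-set topologies and their continuous maps *)

(** An alias indexed by [r], so that each relation puts its own topology on the same carrier. *)
Definition upset_space (T : Type) (r : rel T) : Type := T.

Section UpsetSpace.
Context {T : choiceType} (r : rel T).

Definition upset (U : set T) : Prop := forall x y, U x -> r x y -> U y.

Fact upsetT : upset setT.
Proof. by []. Qed.

Fact upsetI : setI_closed upset.
Proof.
by move=> A B uA uB x y [Ax Bx] rxy; split; [apply: uA rxy | apply: uB rxy].
Qed.

Fact upset_bigcup (I : Type) (f : I -> set T) :
  (forall i, upset (f i)) -> upset (\bigcup_i f i).
Proof. by move=> uf x y [i _ fx] rxy; exists i => //; apply: uf fx rxy. Qed.

HB.instance Definition _ := Choice.copy (upset_space r) T.
HB.instance Definition _ :=
  isOpenTopological.Build (upset_space r) upsetT upsetI upset_bigcup.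

Lemma open_upset (U : set (upset_space r)) : open U = upset U.
Proof. by []. Qed.

Lemma alexandroff_upset_space : alexandroff (upset_space r).
Proof.
move=> F Fopen; rewrite open_upset => x y Fx rxy U FU.
by have := Fopen _ FU; rewrite open_upset => /(_ x y); apply=> //; apply: Fx.
Qed.

End UpsetSpace.

Lemma homo_continuous (T T' : choiceType) (r : rel T) (r' : rel T')
    (f : upset_space r -> upset_space r') :
  {homo f : x y / r x y >-> r' x y} -> continuous f.
Proof.
move=> fr; apply/continuousP => U; rewrite !open_upset => uU x y Ux rxy.
exact: uU Ux (fr _ _ rxy).
Qed.

(** As [r'] is a preorder, the points above [f x] form an open set containing [f x]; its preimage is
    an up-set containing [x], hence also [y]. *)
Lemma continuous_homo (T T' : choiceType) (r : rel T) (r' : rel T')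
    (f : upset_space r -> upset_space r') :
  reflexive r' -> transitive r' -> continuous f ->
  {homo f : x y / r x y >-> r' x y}.
Proof.
move=> rr tr /continuousP fC x y rxy.
have /fC : open ([set z | r' (f x) z] : set (upset_space r')).
  by rewrite open_upset => u v /= + uv; move/tr; apply.
by rewrite open_upset => /(_ x y); apply=> //=.
Qed.

(** * Order axioms and induction derived from least elements *)

Section WellOrder.
Context {T : eqType} {R : rel T} (Rwo : well_order R).

Let Rchain : wo_chain R T.
Proof. by move=> A _; apply: Rwo. Qed.

Lemma well_order_refl : reflexive R.
Proof. by move=> x; apply: (wo_chain_reflexive (@Rchain)). Qed.

Lemma well_order_anti : antisymmetric R.
Proof. by move=> x y; apply: (wo_chain_antisymmetric (@Rchain)). Qed.

Lemma well_order_total : total R.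
Proof. by move=> x y; apply: (wo_chainW (@Rchain)). Qed.

Lemma well_order_ind (P : T -> Prop) :
  (forall i, (forall j, R j i -> j != i -> P j) -> P i) -> forall i, P i.
Proof.
move=> IH i; apply: contrapT => nPi.
have [|m [[/asboolP nPm mmin] _]] := @Rwo (fun j => `[< ~ P j >]).
  by exists i; apply/asboolP.
apply: nPm; apply: IH => j Rjm jm; apply: contrapT => nPj.
have Rmj : R m j by apply: mmin; apply/asboolP.
by rewrite (well_order_anti (introT andP (conj Rjm Rmj))) eqxx in jm.
Qed.

(** The least element of the set of [x], [y], [z] is one of the three: if it is [x] the claim is
    immediate, if it is [y] then [x = y], and if it is [z] then [y = z]. *)
Lemma well_order_trans : transitive R.
Proof.
move=> y x z Rxy Ryz.
have [|m [[mxyz mmin] _]] := @Rwo (mem [:: x; y; z]).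
  by exists x; rewrite !inE eqxx.
have [Rmx Rmy Rmz] : [/\ R m x, R m y & R m z].
  by split; apply: mmin; rewrite !inE eqxx ?orbT.
move: mxyz; rewrite !inE => /or3P[]/eqP em; subst m => //.
- by rewrite (well_order_anti (introT andP (conj Rxy Rmx))).
- by rewrite -(well_order_anti (introT andP (conj Ryz Rmy))).
Qed.

End WellOrder.

(** * The poset attached to a group, and its automorphisms *)

Section CayleyPoset.
Context {G : groupType} (R : rel G).

Definition cayley_le (x y : G * option G) : bool :=
  match x.2, y.2 with
  | None, None => x.1 == y.1
  | None, Some j => R (x.1^-1 * y.1) j
  | Some i, Some j => (x.1 == y.1) && R i j
  | Some _, None => false
  end.

Definition translate (g : G) (x : G * option G) := (g * x.1, x.2).

Lemma translateM g h : translate (g * h) =1 translate g \o translate h.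
Proof. by move=> x; rewrite /translate /= mulgA. Qed.

Lemma translate1 : translate 1 =1 id.
Proof. by case=> k i; rewrite /translate /= mul1g. Qed.

Lemma translateK g : cancel (translate g) (translate g^-1).
Proof. by move=> x; rewrite -[LHS]translateM mulVg translate1. Qed.

Lemma translate_homo g : {homo translate g : x y / cayley_le x y}.
Proof.
case=> k [i|] [h [j|]] //; rewrite /cayley_le /=.
- by case/andP=> /eqP-> ->; rewrite eqxx.
- by rewrite invgM -mulgA mulKg.
- by move/eqP->.
Qed.

Context (Rwo : well_order R).
Let Rrefl := well_order_refl Rwo.
Let Ranti := well_order_anti Rwo.
Let Rtotal := well_order_total Rwo.
Let Rtrans := well_order_trans Rwo.

Lemma cayley_le_refl : reflexive cayley_le.
Proof. by case=> k [i|]; rewrite /cayley_le /= eqxx ?Rrefl. Qed.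

Lemma cayley_le_trans : transitive cayley_le.
Proof.
case=> h [j|] [k [i|]] [l [m|]]; rewrite /cayley_le //=.
- by case/andP=> /eqP-> Rij /andP[/eqP-> /(Rtrans Rij)->]; rewrite eqxx.
- by move=> Rj /andP[/eqP<- /(Rtrans Rj)].
- by move/eqP->.
- by move/eqP->.
Qed.

Lemma cayley_le_None x k : cayley_le x (k, None) -> x = (k, None).
Proof. by case: x => h [j|] //= /eqP /= ->. Qed.

(** Points [(g, Some j)] are not minimal. If one were the image of [(k, None)], then [f'] would send
    a minimal point below it under [(k, None)], hence onto [(k, None)], and applying [f] would
    identify the two points. *)
Lemma homo_None f f' k :
  {homo f' : x y / cayley_le x y} -> cancel f f' -> cancel f' f ->
  (f (k, None)).2 = None.
Proof.
move=> f'le fK f'K; case fk: (f (k, None)) => [g [j|]] //=.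
(* The first component is chosen so that [(g * j^-1)^-1 * g = j]. *)
have /f'le : cayley_le (g * j^-1, None) (g, Some j).
  by rewrite /cayley_le /= invgM invgK mulgVK.
rewrite -fk fK => /cayley_le_None /(congr1 f).
by rewrite f'K fk.
Qed.

(** This is the rigidity of well-orders. If [b] were strictly below [i], monotonicity would send
    [(g, Some b)] to some [(a, Some d)] with [R d b], and induction gives [R b d]; so [(g, Some b)]
    and [(g, Some i)] would have the same image. *)
Lemma homo_Some_ge f g i a b :
  injective f -> {homo f : x y / cayley_le x y} ->
  (forall h j, (f (h, Some j)).2 != None) ->
  f (g, Some i) = (a, Some b) -> R i b.
Proof.
move=> finj fle fS; elim/(well_order_ind Rwo): i => i IH in a b *.
move=> fi; have [//|Rbi] := orP (Rtotal i b).
have [->//|bi] := eqVneq b i.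
have := fle (g, Some b) (g, Some i).
rewrite {1}/cayley_le /= eqxx Rbi fi => /(_ isT).
have := fS g b; case fb: (f (g, Some b)) => [c [d|]] // _.
rewrite /cayley_le /= => /andP[/eqP ca Rdb].
have bd : b = d.
  by apply: Ranti; rewrite Rdb (IH _ Rbi bi _ _ fb).
have /finj[ib] : f (g, Some b) = f (g, Some i) by rewrite fb fi ca bd.
by rewrite ib eqxx in bi.
Qed.

Lemma cayley_automorphism f f' :
  {homo f : x y / cayley_le x y} -> {homo f' : x y / cayley_le x y} ->
  cancel f f' -> cancel f' f -> f =1 translate (f (1, None)).1.
Proof.
move=> fle f'le fK f'K.
have fmono x y : cayley_le (f x) (f y) = cayley_le x y.
  by apply/idP/idP => [/f'le|/fle //]; rewrite !fK.
have fN k : f (k, None) = ((f (k, None)).1, None).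
  by rewrite [LHS]surjective_pairing (homo_None _ f'le fK f'K).
have f'N k : f' (k, None) = ((f' (k, None)).1, None).
  by rewrite [LHS]surjective_pairing (homo_None _ fle f'K fK).
have fS h j : (f (h, Some j)).2 != None.
  case fh: (f (h, Some j)) => [a [b|]] //.
  by have := congr1 f' fh; rewrite fK f'N.
have f'S h j : (f' (h, Some j)).2 != None.
  case fh: (f' (h, Some j)) => [a [b|]] //.
  by have := congr1 f fh; rewrite f'K fN.
have f2 h j : f (h, Some j) = ((f (h, Some j)).1, Some j).
  have := fS h j; case fh: (f (h, Some j)) => [a [b|]] //= _.
  (* Rigidity of [f] gives [R j b], and that of [f'] gives [R b j]. *)
  congr (_, Some _); apply: Ranti.
  rewrite (homo_Some_ge (can_inj fK) fle fS fh) andbT.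
  apply: (homo_Some_ge (can_inj f'K) f'le f'S (_ : f' (a, Some b) = (h, _))).
  by rewrite -fh fK.
have f1 h i j : (f (h, Some i)).1 = (f (h, Some j)).1.
  wlog Rij : i j / R i j.
    by move=> W; have [/W|/W] := orP (Rtotal i j).
  have : cayley_le (f (h, Some i)) (f (h, Some j)).
    by rewrite fmono /cayley_le /= eqxx.
  by rewrite f2 (f2 _ j) => /andP[/eqP].
(* [chi] is the action on minimal points and [psi] the action on copies; by [f1] the level [1] is an
   arbitrary choice. *)
pose chi k := (f (k, None)).1; pose psi g := (f (g, Some 1)).1.
have f_Some g j : f (g, Some j) = (psi g, Some j) by rewrite f2 (f1 _ _ 1).
have fR k g j : R ((chi k)^-1 * psi g) j = R (k^-1 * g) j.
  by have := fmono (k, None) (g, Some j); rewrite fN f_Some.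
(* An element is determined by the set of [j] above it: test [fR] at each of the two elements. *)
have chipsi k g : (chi k)^-1 * psi g = k^-1 * g.
  by apply: Ranti; rewrite fR Rrefl -fR Rrefl.
(* Taking [k = 1] in [chipsi] computes [psi]; taking [g = k] below gives [chi = psi]. *)
have psiE g : psi g = chi 1 * g.
  by rewrite -[psi g](mulVKg (chi 1)) chipsi invg1 mul1g.
have chiE k : chi k = psi k.
  by have := chipsi k k; rewrite mulVg => /mulg1_eq; rewrite invgK.
case=> k [j|]; rewrite /translate /= -/(chi 1); first by rewrite f_Some psiE.
by rewrite fN -/(chi k) chiE psiE.
Qed.

(** * The isomorphism between the group and the homeomorphisms *)

Local Notation X := (upset_space cayley_le).

Fact translate_homeomorphism g : homeomorphism (translate g : X -> X).
Proof.
split; first exact/homo_continuous/translate_homo.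
exists (translate g^-1); split; last 2 first.
- exact: translateK.
- by rewrite -{2}[g]invgK; apply: translateK.
- exact/homo_continuous/translate_homo.
Qed.

Definition translation g : autohomeo X :=
  Autohomeo (translate_homeomorphism g).

Fact translationM : {morph translation : g h / g * h}.
Proof. by move=> g h; apply: autohomeo_eq => x; apply: translateM. Qed.

HB.instance Definition _ :=
  isMultiplicative.Build G (autohomeo X) translation translationM.

Lemma translation_bij : bijective translation.
Proof.
(* A translation is recovered from the image of [(1, None)], whose first component is [g * 1]. *)
exists (fun f : autohomeo X => (f (1, None)).1) => [g|f]; first exact: mulg1.
have [fC [f' [f'C fK f'K]]] := autohomeoP f.
apply: autohomeo_eq => x; apply/esym; apply: cayley_automorphism fK f'K _ => //.
- exact: (continuous_homo cayley_le_refl cayley_le_trans fC).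
- exact: (continuous_homo cayley_le_refl cayley_le_trans f'C).
Qed.

End CayleyPoset.

Theorem theorem1p2 (G : groupType) :
  exists X : topologicalType,
    alexandroff X /\
    exists phi : {multiplicative G -> autohomeo X}, bijective phi.
Proof.
have [R Rwo] := well_ordering_principle G.
exists (upset_space (cayley_le R)); split; first exact: alexandroff_upset_space.
by exists (translation R); apply: translation_bij.
Qed.
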